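(* Let $(X,d_X)$ and $(Y,d_Y)$ be complete locally radially quasi-convex metric spaces. The following are equivalent: (a) $X$ is infinitesimally Lipschitz homeomorphic to $Y$. (b) $D^{\infty}(X)$ is isomorphic to $D^{\infty}(Y)$ as unital algebras. (c) $D^{\infty}(X)$ is isomorphic to $D^{\infty}(Y)$ as unital vector lattices.
   Context: For metric spaces $(X,d_X)$, $(Y,d_Y)$ and $f:X\to Y$, put $\mathrm{Lip} f(x)=\limsup_{y\to x,\,y\neq x}\frac{d_Y(f(x),f(y))}{d_X(x,y)}\in[0,\infty]$ for non-isolated $x\in X$, and $\mathrm{Lip} f(x)=0$ for isolated $x$; $\|\mathrm{Lip} f\|_\infty=\sup_{x\in X}\mathrm{Lip} f(x)$. $D(X,Y)$ is the set of all $f:X\to Y$ with $\|\mathrm{Lip} f\|_\infty<+\infty$. $D^\infty(X)$ is the set of all bounded $f:X\to\mathbb{R}$ with $\|\mathrm{Lip} f\|_\infty<+\infty$; it is a unital real algebra and a unital vector lattice under pointwise operations and pointwise order, the unit being the constant function $1$ (isomorphisms of unital vector lattices are linear lattice isomorphisms preserving $1$). $X$ and $Y$ are infinitesimally Lipschitz homeomorphic if there is a bijection $h:X\to Y$ with $h\in D(X,Y)$ and $h^{-1}\in D(Y,X)$. The length of a continuous curve $\gamma:[a,b]\to X$ is $\ell(\gamma)=\sup\sum_{i=0}^{n-1}d(\gamma(t_i),\gamma(t_{i+1}))$ over all partitions $a=t_0<\dots<t_n=b$; $\gamma$ is rectifiable if $\ell(\gamma)<\infty$. A metric space $(X,d)$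 is locally radially quasi-convex if for each $x\in X$ there exist a neighborhood $U^x$ of $x$ and a constant $K_x>0$ such that for each $y\in U^x$ there is a rectifiable curve $\gamma$ in $U^x$ connecting $x$ and $y$ with $\ell(\gamma)\le K_x d(x,y)$. *)

(* Defs.v *)
From HB Require Import structures.
From mathcomp Require Import all_boot all_order all_algebra.
From mathcomp Require Import all_classical all_reals all_analysis.

Set Implicit Arguments.
Unset Strict Implicit.
Unset Printing Implicit Defensive.

Import Order.TTheory GRing.Theory Num.Theory.
Import numFieldNormedType.Exports.

Local Open Scope classical_set_scope.
Local Open Scope ring_scope.

(* The completeness axiom of [completeType], which itself would force the
   space to be pointed, hence nonempty. *)
Definition complete_space (T : uniformType) : Prop :=
  forall F : set_system T, ProperFilter F -> cauchy F -> exists x : T, F --> x.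

Section PointwiseLipschitz.
Context {R : realType}.

Definition Lip (X Y : metricType R) (f : X -> Y) (x : X) : \bar R :=
  if `[< isolated [set: X] x >] then 0%E
  else limf_esup (fun y => (mdist (f x) (f y) / mdist x y)%:E) x^'.

(* For empty [X] this is [-oo] rather than [0]; only finiteness is used. *)
Definition Lip_norm (X Y : metricType R) (f : X -> Y) : \bar R :=
  ereal_sup (range (Lip f)).

Definition Dspace (X Y : metricType R) : set (X -> Y) :=
  [set f | (Lip_norm f < +oo)%E].

Definition inf_Lipschitz_homeomorphic (X Y : metricType R) : Prop :=
  exists (h : X -> Y) (g : Y -> X),
    [/\ cancel h g, cancel g h, Dspace h & Dspace g].

Definition curve_variation (X : metricType R) (a b : R) (c : R -> X)
    (s : seq R) : R :=
  \sum_(0 <= i < size s) mdist (c (nth b (a :: s) i)) (c (nth b (a :: s) i.+1)).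

Definition curve_length (X : metricType R) (a b : R) (c : R -> X) : \bar R :=
  ereal_sup [set (curve_variation a b c s)%:E | s in itv_partition a b].

Definition curve_joining (X : metricType R) (U : set X) (x y : X)
    (a b : R) (c : R -> X) : Prop :=
  [/\ a <= b, {within `[a, b], continuous c}, c @` `[a, b] `<=` U,
      c a = x & c b = y].

Definition rectifiable (X : metricType R) (a b : R) (c : R -> X) : Prop :=
  (curve_length a b c < +oo)%E.

Definition locally_radially_quasiconvex (X : metricType R) : Prop :=
  forall x : X, exists (U : set X) (K : R), [/\ nbhs x U, 0 < K &
    forall y, U y -> exists (a b : R) (c : R -> X),
      [/\ curve_joining U x y a b c, rectifiable a b c &
          (curve_length a b c <= (K * mdist x y)%:E)%E]].

Lemma Lip_lt_near (X Y : metricType R) (f : X -> Y) (x : X) (K : R) :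
  (Lip f x < K%:E)%E -> \forall y \near x, mdist (f x) (f y) <= K * mdist x y.
Proof.
rewrite /Lip; case: asboolP => [[_ [V xV]]|_].
  rewrite setIT => Vx _; near=> y.
  have -> : y = x by have : V y; [near: y|rewrite Vx].
  by rewrite !mdistxx mulr0.
move=> /ereal_inf_ltP[_ [V xV <-] supK].
near=> y; have [->|yx] := eqVneq y x; first by rewrite !mdistxx mulr0.
have Vy : V y by move: yx; near: y.
rewrite -ler_pdivrMr ?mdist_gt0 1?eq_sym// -lee_fin.
by apply/ltW/(le_lt_trans _ supK)/ereal_sup_ubound; exists y.
Unshelve. all: by end_near. Qed.

Lemma near_Lip_le (X Y : metricType R) (f : X -> Y) (x : X) (K : R) : 0 <= K ->
  (\forall y \near x, mdist (f x) (f y) <= K * mdist x y) ->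
  (Lip f x <= K%:E)%E.
Proof.
move=> K0 fK; rewrite /Lip; case: asboolP => _; first by rewrite lee_fin.
pose V := [set y | y != x /\ mdist (f x) (f y) <= K * mdist x y].
apply: (@le_trans _ _ (ereal_sup
    ((fun y => (mdist (f x) (f y) / mdist x y)%:E) @` V))).
  apply: ereal_inf_lbound; exists V => //.
  by apply: filterS fK => y ? ?.
apply: ge_ereal_sup => _ [y [yx fyK] <-].
by rewrite lee_fin ler_pdivrMr ?mdist_gt0 1?eq_sym.
Qed.

Lemma DspaceP (X Y : metricType R) (f : X -> Y) : Dspace f <->
  exists K : R, forall x, \forall y \near x, mdist (f x) (f y) <= K * mdist x y.
Proof.
split=> [|[K fK]].
  rewrite /Dspace/= => fy.
  have [K fK] : exists K : R, (Lip_norm f < K%:E)%E.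
    move: fy; case: (Lip_norm f) => [r _|//|_]; last by exists 0; exact: ltNyr.
    by exists (r + 1); rewrite lte_fin ltrDl.
  exists K => x; apply/Lip_lt_near/(le_lt_trans _ fK).
  by apply: ereal_sup_ubound; exists x.
rewrite /Dspace/=; apply: (@le_lt_trans _ _ `|K|%:E); last exact: ltry.
apply: ge_ereal_sup => _ [x _ <-]; apply: near_Lip_le => //.
apply: filterS (fK x) => y /le_trans; apply.
by rewrite ler_wpM2r// ?mdist_ge0// ler_norm.
Qed.

Definition Dinf_pred (X : metricType R) : {pred X -> R^o} :=
  mem [set f : X -> R^o | bounded_fun f /\ Dspace f].
Arguments Dinf_pred : clear implicits.

Lemma Dinf_predP (X : metricType R) (f : X -> R^o) : f \in Dinf_pred X <->
  exists K : R, forall x, `|f x| <= K /\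
    \forall y \near x, `|f y - f x| <= K * mdist x y.
Proof.
split=> [/set_mem[/pinfty_ex_gt0[M _ fM] /DspaceP[K fK]]|[K fK]].
  exists (Num.max M K) => x; split; first by rewrite le_max fM.
  apply: filterS (fK x) => y /le_trans; apply.
  by rewrite ler_wpM2r ?mdist_ge0// le_max lexx orbT.
apply/mem_set; split; last by apply/DspaceP; exists K => x; have [] := fK x.
exists K; split; first exact: num_real.
by move=> M KM x _; apply: le_trans (ltW KM); have [] := fK x.
Qed.

Lemma Dinf_submod_closed (X : metricType R) : submod_closed (Dinf_pred X).
Proof.
split=> [|k f g /Dinf_predP[K fK] /Dinf_predP[L gL]].
  by apply/Dinf_predP; exists 0 => x; rewrite normr0; split=> //; near=> y;
    rewrite subr0 normr0 mul0r.
apply/Dinf_predP; exists (`|k| * K + L) => x; split.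
  rewrite (le_trans (ler_normD _ _))// lerD//; last by have [] := gL x.
  by rewrite normrM ler_wpM2l//; have [] := fK x.
have [_ fx] := fK x; have [_ gx] := gL x; near=> y.
have -> : (k *: f + g) y - (k *: f + g) x = k * (f y - f x) + (g y - g x).
  by rewrite mulrBr opprD addrACA.
rewrite (le_trans (ler_normD _ _))// mulrDl lerD//; last by near: y.
by rewrite normrM -mulrA ler_wpM2l//; near: y.
Unshelve. all: by end_near. Qed.

Lemma Dinf_subring_closed (X : metricType R) : subring_closed (Dinf_pred X).
Proof.
split=> [|f g fD gD|f g /Dinf_predP[K fK] /Dinf_predP[L gL]].
- apply/Dinf_predP; exists 1 => x; rewrite normr1; split=> //; near=> y.
  by rewrite subrr normr0 mul1r mdist_ge0.
- by rewrite addrC -scaleN1r; apply: (Dinf_submod_closed X).2.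
- apply/Dinf_predP; exists (K * L + K * L) => x.
  have [fxK fx] := fK x; have [gxL gx] := gL x.
  have K0 : 0 <= K := le_trans (normr_ge0 _) fxK.
  have L0 : 0 <= L := le_trans (normr_ge0 _) gxL.
  split.
    by rewrite ler_wpDr ?mulr_ge0// normrM ler_pM.
  near=> y; have [fyK _] := fK y.
  have -> : (f * g) y - (f * g) x = f y * (g y - g x) + (f y - f x) * g x.
    by rewrite mulrBr mulrBl addrA subrK.
  rewrite (le_trans (ler_normD _ _))// [leRHS]mulrDl lerD// normrM.
    by rewrite -mulrA ler_pM//; near: y.
  by rewrite mulrAC ler_pM//; near: y.
Unshelve. all: by end_near. Qed.

Lemma Dinf_norm (X : metricType R) (f : X -> R^o) :
  f \in Dinf_pred X -> (fun x => `|f x| : R^o) \in Dinf_pred X.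
Proof.
move=> /Dinf_predP[K fK]; apply/Dinf_predP; exists K => x; have [fx fxy] := fK x.
rewrite normr_id; split=> //; apply: filterS fxy => y; apply: le_trans.
exact: ler_dist_dist.
Qed.

Lemma Dinf_half (X : metricType R) (f g h : X -> R^o) :
  f \in Dinf_pred X -> g \in Dinf_pred X -> h \in Dinf_pred X ->
  2^-1 *: (h + (f + g)) \in Dinf_pred X.
Proof.
have [D0 DZ] := Dinf_submod_closed X.
move=> fD gD hD; rewrite -[_ *: _]addr0 DZ// -[h]scale1r DZ//.
by rewrite -[f]scale1r DZ.
Qed.

Lemma Dinf_join_closed (X : metricType R) :
  {in Dinf_pred X &, forall f g, (f `|` g)%O \in Dinf_pred X}.
Proof.
move=> f g fD gD.
have [_ DB _] := Dinf_subring_closed X.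
have -> : (f `|` g)%O = 2^-1 *: ((fun x => `|(f - g) x| : R^o) + (f + g)).
  apply/funext => x; rewrite joinfE joinEtotal maxr_absE addrC.
  by rewrite -[RHS]/(2^-1 * _) mulrC.
by apply: Dinf_half => //; apply/Dinf_norm/DB.
Qed.

Lemma Dinf_meet_closed (X : metricType R) :
  {in Dinf_pred X &, forall f g, (f `&` g)%O \in Dinf_pred X}.
Proof.
move=> f g fD gD.
have [_ DB _] := Dinf_subring_closed X.
have -> : (f `&` g)%O = f + g - (f `|` g)%O.
  apply/funext => x; rewrite meetfE meetEtotal.
  rewrite -[RHS]/(f x + g x - _) joinfE joinEtotal.
  by rewrite Num.Theory.minr_to_max.
apply: DB; last exact: Dinf_join_closed.
have [_ DZ] := Dinf_submod_closed X.
by rewrite -[f]scale1r DZ.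
Qed.

End PointwiseLipschitz.
Arguments Dinf_pred {R} X.

Section Dinf_structures.
Context {R : realType} (X : metricType R).

Record Dinf := MkDinf { Dinf_fun :> X -> R^o; _ : Dinf_fun \in Dinf_pred X }.

HB.instance Definition _ := [isSub for Dinf_fun].
HB.instance Definition _ := [Choice of Dinf by <:].
HB.instance Definition _ := GRing.SubChoice_isSubComPzRing.Build
  (X -> R^o) (Dinf_pred X) Dinf (Dinf_subring_closed X).
HB.instance Definition _ := GRing.isSubmodClosed.Build
  R (X -> R^o) (Dinf_pred X) (Dinf_submod_closed X).
HB.instance Definition _ := [SubZmodule_isSubLmodule of Dinf by <:].
HB.instance Definition _ := Order.isLatticeClosed.Build
  _ (X -> R^o) (Dinf_pred X) (@Dinf_meet_closed R X) (@Dinf_join_closed R X).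
HB.instance Definition _ :=
  [SubChoice_isSubLattice of Dinf by <: with FunOrder.fun_display].

Implicit Types f g : Dinf.

Lemma Dinf_addE f g x : (f + g) x = f x + g x. Proof. by []. Qed.
Lemma Dinf_scaleE (k : R) f x : (k *: f) x = k * f x. Proof. by []. Qed.
Lemma Dinf_oneE x : (1 : Dinf) x = 1. Proof. by []. Qed.
Lemma Dinf_mulE f g x : (f * g) x = f x * g x. Proof. by []. Qed.

Lemma Dinf_leP f g : reflect (forall x, f x <= g x) (f <= g)%O.
Proof. exact: lefP. Qed.

Lemma Dinf_joinE f g x : (f `|` g)%O x = Num.max (f x) (g x).
Proof. by rewrite -joinEtotal. Qed.

Lemma Dinf_meetE f g x : (f `&` g)%O x = Num.min (f x) (g x).
Proof. by rewrite -meetEtotal. Qed.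

End Dinf_structures.

(* [Dinf X] is the zero ring when [X] is empty, so it cannot be an [algType]
   (whose underlying ring is nontrivial) and [{lrmorphism _ -> _}] is not
   available; its two constituents are used instead. *)
Definition unital_algebra_isomorphic (R : realType) (X Y : metricType R) :
    Prop :=
  exists phi : Dinf X -> Dinf Y,
    [/\ bijective phi, linear phi & monoid_morphism phi].

Definition unital_vector_lattice_isomorphic (R : realType)
    (X Y : metricType R) : Prop :=
  exists phi : Dinf X -> Dinf Y,
    [/\ bijective phi, linear phi, Order.meet_morphism phi,
        Order.join_morphism phi & phi 1 = 1].

(* Main.v *)
Require Import Defs.
From mathcomp Require Import all_boot all_order all_algebra.
From mathcomp Require Import all_classical all_reals all_analysis.
From mathcomp Require Import ring lra.

(** A homeomorphism with both directions pointwise Lipschitz acts on [Dinf] by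
composition, which gives (a) => (b). For the way back only the order matters.
An algebra isomorphism preserves it because [f >= 0] holds exactly when
[f + c] is invertible for every constant [c > 0]
([Dinf_ge0P], [algebra_iso_order]), and lattice isomorphisms preserve it by
definition; so (b) => (c), and it remains to show that a linear order
isomorphism [phi] fixing [1] comes from a homeomorphism of the required kind.

Points are recovered as follows ([order_iso_point]). Fix [y : Y] and let
[w = min(1, d(y, -))]. Each [g] in [Dinf Y] is bounded and Lipschitz at [y], so
[|g - g y| <= M w] on all of [Y]; transported by the inverse isomorphism
[psi], this reads [|f - phi f y| <= M (psi w)] on [X] for each [f] in
[Dinf X]. Since [w] has infimum [0], so does [psi w], and along a
sequence [a n] with [psi w (a n) --> 0] every [f] converges to [phi f y]. In a
complete space this forces [a] to converge ([weakly_cvg_cvg]): otherwise [a]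
would have a uniformly separated subsequence, and the distance to its
even-indexed terms would be a member of [Dinf X] that does not converge along
[a]. The limit [x] satisfies [phi f y = f x] for all [f]. Thus
[phi f = f \o k] with [k : Y -> X], likewise [psi g = g \o h], and [h], [k] are
inverse to each other because [Dinf] separates points.

Finally a map [h] such that [f \o h] is in [Dinf] for all [f] in [Dinf] is
itself pointwise Lipschitz with a uniform constant ([Dspace_of_comp]). If not,
there are points [y n] where the constant [n] fails, and they can be chosen so
that every [h (y n)] is isolated among the others ([isolated_choice]). Then a
single [f], the distance to the set of these points capped at [1], coincides
near each [h (y n)] with the distance to [h (y n)], so the pointwise Lipschitz
constant of [f \o h] at [y n] is that of [h], which exceeds [n]. *)

Set Implicit Arguments.
Unset Strict Implicit.
Unset Printing Implicit Defensive.

Import Order.TTheory GRing.Theory Num.Theory.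
Import numFieldNormedType.Exports.

Local Open Scope classical_set_scope.
Local Open Scope ring_scope.

(** * Members of the function space *)

Lemma DinfP (R : realType) (X : metricType R) (f : Dinf X) :
  exists2 K : R, 0 <= K & forall x, `|f x| <= K /\
    \forall y \near x, `|f y - f x| <= K * mdist x y.
Proof.
have [K fK] := (Dinf_predP _).1 (valP f).
exists `|K| => // x; have [fx fxy] := fK x; split.
  exact: le_trans (ler_norm K).
apply: filterS fxy => y /le_trans; apply.
by rewrite ler_wpM2r ?mdist_ge0 ?ler_norm.
Qed.

Lemma nbhs_mdist_lt (R : realType) (X : metricType R) (x : X) (e : R) :
  0 < e -> \forall y \near x, mdist x y < e.
Proof.
by move=> e0; have := nbhsx_ballx x e e0; rewrite ballEmdist.
Qed.

Lemma Dinf_continuous (R : realType) (X : metricType R) (f : Dinf X) :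
  continuous (f : X -> R^o).
Proof.
move=> x; have [K K0 /(_ x)[_ fx]] := DinfP f.
have K1 : 0 < K + 1 by rewrite ltr_wpDl.
apply/cvgrPdist_lt => e e0; near=> y; rewrite distrC.
apply: (@le_lt_trans _ _ (K * mdist x y)); first by near: y.
apply: (@le_lt_trans _ _ ((K + 1) * mdist x y)).
  by rewrite ler_wpM2r ?mdist_ge0// lerDl.
rewrite mulrC -ltr_pdivlMr//; near: y.
by apply: nbhs_mdist_lt; rewrite divr_gt0.
Unshelve. all: by end_near. Qed.

Lemma Dinf_comp (R : realType) (X Y : metricType R) (h : Y -> X)
  (f : Dinf X) : Dspace h -> (f \o h : Y -> R^o) \in Dinf_pred Y.
Proof.
move=> /DspaceP[L hL]; have [K K0 fK] := DinfP f.
have L0 : 0 <= Num.max L 0 by rewrite le_max lexx orbT.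
apply/Dinf_predP; exists (Num.max K (K * Num.max L 0)) => y.
have [fy fyz] := fK (h y); split; first by rewrite le_max fy.
have hLy : \forall z \near y, mdist (h y) (h z) <= Num.max L 0 * mdist y z.
  apply: filterS (hL y) => z /le_trans; apply.
  by rewrite ler_wpM2r ?mdist_ge0// le_max lexx.
have hy : h z @[z --> y] --> h y.
  apply/metricType_numDomainType.cvgrPdist_lt => e e0.
  have L1 : 0 < Num.max L 0 + 1 by rewrite ltr_wpDl.
  near=> z; apply: (@le_lt_trans _ _ (Num.max L 0 * mdist y z)).
    by near: z.
  apply: (@le_lt_trans _ _ ((Num.max L 0 + 1) * mdist y z)).
    by rewrite ler_wpM2r ?mdist_ge0// lerDl.
  rewrite mulrC -ltr_pdivlMr//; near: z.
  by apply: nbhs_mdist_lt; rewrite divr_gt0.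
near=> z; apply: (@le_trans _ _ (K * mdist (h y) (h z))).
  by near: z; exact: (hy _ fyz).
apply: (@le_trans _ _ (K * Num.max L 0 * mdist y z)).
  by rewrite -mulrA ler_wpM2l//; near: z.
by rewrite ler_wpM2r ?mdist_ge0// le_max lexx orbT.
Unshelve. all: by end_near. Qed.

(** * Capped distance to a set *)

(** The cap keeps the function bounded; for empty [A] the infimum is [0], so the
function is a member of [Dinf] for every [A]. *)
Definition capped_dist (R : realType) (X : metricType R) (A : set X) (x : X) :=
  inf [set Num.min 1 (mdist x a) | a in A] : R.

Section capped_dist_theory.
Context (R : realType) (X : metricType R).
Implicit Types (A : set X) (x y a : X).

Let capped_has_lbound A x :
  has_lbound [set Num.min 1 (mdist x a) | a in A].
Proof. by exists 0 => _ [a _ <-]; rewrite le_min ler01 mdist_ge0. Qed.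

Lemma capped_dist_le_min A x a :
  A a -> capped_dist A x <= Num.min 1 (mdist x a).
Proof. by move=> Aa; apply: ge_inf => //; exists a. Qed.

Lemma capped_dist_ge A x (r : R) : A !=set0 ->
  (forall a, A a -> r <= Num.min 1 (mdist x a)) -> r <= capped_dist A x.
Proof.
move=> [a Aa] rA; apply: lb_le_inf; first by exists (Num.min 1 (mdist x a)), a.
by move=> _ [b Ab <-]; exact: rA.
Qed.

Lemma capped_dist_set0 x : capped_dist set0 x = 0.
Proof. by rewrite /capped_dist image_set0 inf0. Qed.

Lemma capped_dist_ge0 A x : 0 <= capped_dist A x.
Proof.
have [->|/set0P A0] := eqVneq A set0; first by rewrite capped_dist_set0.
by apply: capped_dist_ge => // a _; rewrite le_min ler01 mdist_ge0.
Qed.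

Lemma capped_dist_le1 A x : capped_dist A x <= 1.
Proof.
have [->|/set0P[a Aa]] := eqVneq A set0.
  by rewrite capped_dist_set0 ler01.
by rewrite (le_trans (capped_dist_le_min x Aa))// ge_min lexx.
Qed.

Lemma capped_dist_mem A a : A a -> capped_dist A a = 0.
Proof.
move=> Aa; apply/eqP; rewrite eq_le capped_dist_ge0 andbT.
by rewrite (le_trans (capped_dist_le_min a Aa))// mdistxx ge_min lexx orbT.
Qed.

Lemma capped_dist1 a x : capped_dist [set a] x = Num.min 1 (mdist x a).
Proof. by rewrite /capped_dist image_set1 inf1. Qed.

Lemma capped_dist_lipschitz A x y :
  `|capped_dist A y - capped_dist A x| <= mdist x y.
Proof.
suff H u v : capped_dist A u <= capped_dist A v + mdist u v.
  by rewrite ler_distl lerBlDr H/= metric_sym H.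
have [->|/set0P A0] := eqVneq A set0.
  by rewrite !capped_dist_set0 add0r mdist_ge0.
rewrite -lerBlDr; apply: capped_dist_ge => // a Aa.
rewrite lerBlDr (le_trans (capped_dist_le_min u Aa))//.
rewrite addr_minl le_min 2!ge_min lerDl mdist_ge0/=.
by rewrite addrC metric_triangle orbT.
Qed.

Lemma capped_dist_Dinf A : (capped_dist A : X -> R^o) \in Dinf_pred X.
Proof.
apply/Dinf_predP; exists 1 => x; split.
  by rewrite ger0_norm ?capped_dist_ge0 ?capped_dist_le1.
by apply: filterE => y; rewrite mul1r capped_dist_lipschitz.
Qed.

Definition Dinf_dist A : Dinf X := MkDinf (capped_dist_Dinf A).

End capped_dist_theory.

Lemma Dinf_separated (R : realType) (X : metricType R) (x x' : X) :
  (forall f : Dinf X, f x = f x') -> x = x'.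
Proof.
move=> /(_ (Dinf_dist [set x'])); rewrite /= !capped_dist1 mdistxx.
rewrite (min_idPr (ler01 : 0 <= 1 :> R)) => /eqP.
rewrite minEle; case: ifP => _; first by rewrite oner_eq0.
by move=> /eqP/mdist_positivity.
Qed.

(** * Recovering points from order isomorphisms *)

(** If no ball of radius [e] around a point contains almost all terms, then
for each [x] the limit of [min(1, d(x, -))] along [a] is positive, uniformly
in [x]. So after each term one can wait until all later terms are far from it;
this yields a separated subsequence, whose even and odd terms are told apart
by the distance to the even ones. *)
Lemma weakly_cvg_cvg (R : realType) (X : metricType R) (a : nat -> X) :
  complete_space X ->
  (forall f : Dinf X, exists c : R,
    (f (a n) : R^o) @[n --> \oo] --> (c : R^o)) ->
  exists x : X, a @ \oo --> x.
Proof.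
move=> cX af; apply: cX; apply/cauchy_exP => e e0.
apply: contrapT => /forallNP far.
pose r : R := Num.min 1 e.
have r0 : 0 < r by rewrite lt_min ltr01.
have sep x : exists N, forall n, (N <= n)%N ->
    r / 2 <= Num.min 1 (mdist x (a n)).
  have [c fc] := af (Dinf_dist [set x]).
  have [cr|rc] := ltP c r.
    exfalso; apply: (far x).
    have rc0 : 0 < r - c by rewrite subr_gt0.
    have [N _ fN] := (cvgrPdist_lt _ _).1 fc _ rc0.
    exists N => // n /= /fN /=.
    rewrite distrC => /(le_lt_trans (ler_norm _)).
    rewrite ltrD2r capped_dist1 ballEmdist /= metric_sym /r lt_min gt_min ltxx.
    by move=> /andP[/= n1]; rewrite gt_min => /orP[/(lt_trans n1)|].
  have [N _ fN] := (cvgrPdist_lt _ _).1 fc _ (divr_gt0 r0 (ltr0Sn _ 1)).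
  exists N => n /= /fN /=; rewrite capped_dist1 (metric_sym (a n)).
  by move=> /(le_lt_trans (ler_norm _)); lra.
have [N NP] := choice sep.
(* [k] enumerates the separated subsequence: [N (a n)] is the moment from
   which the terms stay away from [a n]. *)
pose k i := iter i (fun n => maxn n.+1 (N (a n))) 0%N.
have kS i : (k i < k i.+1)%N && (N (a (k i)) <= k i.+1)%N.
  by rewrite /= -/(k i) leq_maxl leq_maxr.
have k_lt i j : (i < j)%N -> (N (a (k i)) <= k j)%N.
  elim: j => // j IH; rewrite ltnS leq_eqVlt => /predU1P[<-|ij].
    by case/andP: (kS i).
  by rewrite (leq_trans (IH ij))// ltnW//; case/andP: (kS j).
have k_ge i : (i <= k i)%N.
  by elim: i => // i /leq_ltn_trans; apply; case/andP: (kS i).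
have aksep i j : i != j -> r / 2 <= Num.min 1 (mdist (a (k i)) (a (k j))).
  case: ltngtP => // ij _; first exact/NP/k_lt.
  by rewrite metric_sym; exact/NP/k_lt.
pose A := range (fun i => a (k i.*2)).
have [c fc] := af (Dinf_dist A).
have [M _ fM] := (cvgrPdist_lt _ _).1 fc _ (divr_gt0 r0 (ltr0Sn _ 3)).
have M2 : (M <= M.*2)%N by rewrite -addnn leq_addr.
have /= := fM (k M.*2) (leq_trans M2 (k_ge _)).
rewrite capped_dist_mem; last by exists M.
have /= := fM (k M.*2.+1) (leq_trans M2 (leq_trans (leqnSn _) (k_ge _))).
have : r / 2 <= capped_dist A (a (k M.*2.+1)).
  apply: capped_dist_ge; first by exists (a (k 0%N.*2)); exists 0%N.
  move=> _ [i _ <-]; apply: aksep; apply/eqP => /(congr1 odd).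
  by rewrite /= !odd_double.
rewrite !ltr_norml => h /andP[h1 h2] /andP[h3 h4]; lra.
Qed.

Definition unital_order_isomorphism (R : realType) (X Y : metricType R)
    (phi : Dinf X -> Dinf Y) (psi : Dinf Y -> Dinf X) : Prop :=
  [/\ cancel phi psi, cancel psi phi, linear phi, phi 1 = 1 &
      forall f g, (phi f <= phi g)%O = (f <= g)%O].

Section unital_order_isomorphism_theory.
Context (R : realType) (X Y : metricType R).
Implicit Types (phi : Dinf X -> Dinf Y) (psi : Dinf Y -> Dinf X).

Lemma order_iso_sym phi psi :
  unital_order_isomorphism phi psi -> unital_order_isomorphism psi phi.
Proof.
move=> [phiK psiK lin phi1 phi_le]; split=> //.
- by move=> a f g; apply: (can_inj phiK); rewrite lin !psiK.
- by apply: (can_inj phiK); rewrite psiK phi1.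
- by move=> f g; rewrite -phi_le !psiK.
Qed.

Lemma order_iso_cst phi psi (c : R) :
  unital_order_isomorphism phi psi ->
  phi (c *: (1 : Dinf X)) = c *: (1 : Dinf Y).
Proof.
move=> [_ _ lin phi1 _]; have cE (Z : metricType R) :
    c *: (1 : Dinf Z) = (c - 1) *: (1 : Dinf Z) + 1.
  by rewrite -{3}[1]scale1r -scalerDl subrK.
by rewrite cE lin phi1 -cE.
Qed.

(** Such an estimate is a pair of inequalities between linear combinations of
[f], [w] and [1], hence is visible to the ordered vector space. *)
Lemma order_iso_bound phi psi (f w : Dinf X) (c M : R) :
  unital_order_isomorphism phi psi ->
  (forall x, `|f x - c| <= M * w x) -> forall y, `|phi f y - c| <= M * phi w y.
Proof.
move=> iso fw; have [_ _ lin _ phi_le] := iso.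
have phiE m : phi (m *: w + c *: (1 : Dinf X)) = m *: phi w + c *: (1 : Dinf Y).
  by rewrite lin (order_iso_cst c iso).
have fle : (f <= M *: w + c *: (1 : Dinf X))%O.
  apply/Dinf_leP => x; have := fw x; rewrite ler_distl => /andP[_].
  by rewrite Dinf_addE !Dinf_scaleE Dinf_oneE mulr1 addrC.
have fge : ((- M) *: w + c *: (1 : Dinf X) <= f)%O.
  apply/Dinf_leP => x; have := fw x; rewrite ler_distl => /andP[+ _].
  by rewrite Dinf_addE !Dinf_scaleE Dinf_oneE mulr1 addrC mulNr.
move=> y; move: fle fge; rewrite -phi_le => fle; rewrite -phi_le => fge.
rewrite ler_distl; apply/andP; split.
  move: fge; rewrite phiE => /Dinf_leP/(_ y).
  by rewrite Dinf_addE !Dinf_scaleE Dinf_oneE mulr1 addrC mulNr.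
move: fle; rewrite phiE => /Dinf_leP/(_ y).
by rewrite Dinf_addE !Dinf_scaleE Dinf_oneE mulr1 addrC.
Qed.

End unital_order_isomorphism_theory.

(** Near [y] this is the Lipschitz condition at [y]; away from [y] the right
factor is bounded below and [g] is bounded. *)
Lemma Dinf_dist_bound (R : realType) (Y : metricType R) (g : Dinf Y) (y : Y) :
  exists2 M : R, 0 <= M &
    forall z, `|g z - g y| <= M * capped_dist [set y] z.
Proof.
have [K K0 gK] := DinfP g.
have /nbhs_ballP[e /= e0 eK] := (gK y).2.
have Ke0 : 0 <= K / e by rewrite divr_ge0// ltW.
(* The bounds serve [d(y, z) < e], [1 <= d(y, z)] and the range between. *)
exists (Num.max K (Num.max (2 * K) (2 * (K / e)))).
  by rewrite le_max K0.
move=> z; rewrite capped_dist1 metric_sym.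
have g2K : `|g z - g y| <= 2 * K.
  rewrite mulr_natl mulr2n (le_trans (ler_normB _ _))// lerD//.
    by have [] := gK z.
  by have [] := gK y.
have [yz|yz] := leP 1 (mdist y z).
  by rewrite mulr1 !le_max g2K orbT.
have [ze|ze] := ltP (mdist y z) e.
  have := eK z; rewrite ballEmdist => /(_ ze)/le_trans; apply.
  by rewrite ler_wpM2r ?mdist_ge0// le_max lexx.
apply: (le_trans g2K); apply: (@le_trans _ _ (2 * (K / e) * mdist y z)).
  rewrite -mulrA ler_pM2l// -mulrA ler_peMr//.
  by rewrite mulrC ler_pdivlMr// mul1r.
by rewrite ler_wpM2r ?mdist_ge0// !le_max lexx !orbT.
Qed.

(** A unital order isomorphism composed with evaluation at [y] is evaluation at
some point of [X]: the limit of any sequence along which the preimage of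
[min(1, d(y, -))] tends to [0]. *)
Lemma order_iso_point (R : realType) (X Y : metricType R)
    (phi : Dinf X -> Dinf Y) (psi : Dinf Y -> Dinf X) :
  complete_space X -> unital_order_isomorphism phi psi ->
  forall y, exists x, forall f, phi f y = f x.
Proof.
move=> cX iso y; have iso' := order_iso_sym iso.
have [phiK psiK _ _ phi_le] := iso.
pose w := Dinf_dist [set y].
have wP (f : Dinf X) : exists2 M : R, 0 <= M &
    forall x, `|f x - phi f y| <= M * psi w x.
  have [M M0 fM] := Dinf_dist_bound (phi f) y; exists M => //.
  by have := order_iso_bound (w := w) iso' fM; rewrite phiK.
have /choice[a aP] : forall n : nat, exists x, psi w x < n.+1%:R^-1.
  move=> n; apply: contrapT => /forallNP nw.
  have : (n.+1%:R^-1 *: (1 : Dinf X) <= psi w)%O.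
    apply/Dinf_leP => x; rewrite Dinf_scaleE Dinf_oneE mulr1 leNgt.
    exact/negP/nw.
  rewrite -phi_le psiK (order_iso_cst _ iso) => /Dinf_leP/(_ y).
  rewrite Dinf_scaleE Dinf_oneE mulr1 /= capped_dist_mem//.
  by rewrite leNgt invr_gt0 ltr0Sn.
have fa (f : Dinf X) : (f (a n) : R^o) @[n --> \oo] --> (phi f y : R^o).
  have [M M0 fM] := wP f.
  have M1 : 0 < M + 1 by rewrite ltr_wpDl.
  apply/cvgrPdist_lt => e e0; near=> n; rewrite distrC.
  apply: (le_lt_trans (fM _)).
  apply: (@le_lt_trans _ _ ((M + 1) * n.+1%:R^-1)).
    apply: (le_trans (ler_wpM2l M0 (ltW (aP n)))).
    by rewrite ler_wpM2r ?invr_ge0 ?ler0n// lerDl.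
  rewrite mulrC -ltr_pdivlMr//; near: n.
  by apply: (near_infty_natSinv_lt (PosNum (divr_gt0 e0 M1))).
have [|x ax] := weakly_cvg_cvg cX (a := a).
  by move=> f; exists (phi f y).
exists x => f; have H := @norm_hausdorff R R^o.
apply: (cvg_unique H (fa f)).
apply: (@cvg_comp _ _ _ a (f : X -> R^o) _ _ _ ax).
exact: Dinf_continuous.
Unshelve. all: by end_near. Qed.

(** * Maps that pull the function space back into itself *)

(** If some point [q] is a limit of points of every [B n] other than [q], a
sequence converging to [q] works: around a term there is room before reaching
[q], and only finitely many terms are that far from [q]. If there is no such
[q], any choice works: every point has a neighbourhood that some [B N] meets
at most in that point, so no late term comes close to a given term without
being equal to it. In both cases only finitely many terms remain to be
avoided. *)
Lemma isolated_choice (R : realType) (X : metricType R) (B : nat -> set X) :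
  (forall m n, (m <= n)%N -> B n `<=` B m) -> (forall n, B n !=set0) ->
  exists x : nat -> X, (forall n, B n (x n)) /\
    forall n, exists2 r : R, 0 < r &
      forall m, x m = x n \/ r <= mdist (x n) (x m).
Proof.
move=> B_le B0.
suff [x [xB xisol]] : exists x : nat -> X, (forall n, B n (x n)) /\
    forall n, exists2 r : R, 0 < r &
      exists N, forall m, (N <= m)%N -> x m = x n \/ r <= mdist (x n) (x m).
  exists x; split=> // n; have [r r0 [N rN]] := xisol n.
  (* Shrink [r] to account for the first [N] terms, one at a time. *)
  elim: N r r0 rN => [|N IH] r r0 rN; first by exists r => // m; exact: rN.
  have [E|E] := pselect (x N = x n).
    apply: (IH r r0) => m; rewrite leq_eqVlt => /predU1P[<-|]; first by left.
    exact: rN.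
  apply: (IH (Num.min r (mdist (x n) (x N)))).
    by rewrite lt_min r0 mdist_gt0; apply/eqP => /esym.
  move=> m; rewrite leq_eqVlt => /predU1P[<-|/rN[->|rm]].
  - by right; rewrite ge_min lexx orbT.
  - by left.
  - by right; rewrite ge_min rm.
have [[q qP]|nq] := pselect (exists q, forall (n : nat) (e : R), 0 < e ->
    exists x, [/\ B n x, q != x & mdist q x < e]).
  have /choice[x xP] : forall n : nat, exists x,
      [/\ B n x, q != x & mdist q x < n.+1%:R^-1].
    by move=> n; apply: qP; rewrite invr_gt0 ltr0Sn.
  exists x; split=> [n|n]; first by have [] := xP n.
  have [_ qx _] := xP n; have d0 : 0 < mdist q (x n) / 2.
    by rewrite divr_gt0// mdist_gt0.
  exists (mdist q (x n) / 2) => //.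
  have [N _ NP] := near_infty_natSinv_lt (PosNum d0).
  exists N => m Nm; right; have [_ _ qm] := xP m.
  have := lt_trans qm (NP m Nm).
  have := metric_triangle q (x m) (x n).
  rewrite /= (metric_sym (x m)); lra.
have [x xB] := choice B0.
exists x; split=> // n.
move/forallNP: nq => /(_ (x n))/existsNP[N /existsNP[e]].
move=> /not_implyP[e0 /forallNP xN].
exists e => //; exists N => m Nm.
have [->|xne] := eqVneq (x n) (x m); first by left.
right; rewrite leNgt; apply/negP => xme; apply: (xN (x m)); split=> //.
exact: B_le (xB m).
Qed.

(** The converse of [Dinf_comp]. A failure of the uniform Lipschitz bound is
concentrated into one test function, the capped distance to a set of isolated
values of [h]. *)
Lemma Dspace_of_comp (R : realType) (X Y : metricType R) (h : Y -> X) :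
  (forall f : Dinf X, exists g : Dinf Y, forall y, g y = f (h y)) -> Dspace h.
Proof.
move=> hD; apply: contrapT => /DspaceP/forallNP nhD.
pose bad (K : R) y := ~ \forall z \near y, mdist (h y) (h z) <= K * mdist y z.
have bad_le K L y : K <= L -> bad L y -> bad K y.
  move=> KL bL bK; apply: bL; apply: filterS bK => z /le_trans; apply.
  by rewrite ler_wpM2r ?mdist_ge0.
have badx K : exists y, bad K y by apply/existsNP/nhD.
(* The distance to [h y] pulls back to a continuous function. *)
have h_cts y e : 0 < e -> \forall z \near y, mdist (h y) (h z) < e.
  move=> e0; have [g gE] := hD (Dinf_dist [set h y]).
  have e1 : 0 < Num.min 1 e by rewrite lt_min ltr01.
  have gy := (cvgrPdist_lt _ _).1 (@Dinf_continuous _ _ g y) _ e1.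
  apply: filterS (gy _) => z; rewrite !gE/= capped_dist_mem// sub0r normrN.
  rewrite ger0_norm ?capped_dist_ge0// capped_dist1 metric_sym.
  rewrite lt_min gt_min ltxx /= => /andP[z1].
  by rewrite gt_min => /orP[/(lt_trans z1)|].
have [x [xB xiso]] : exists x : nat -> X, (forall n, (h @` bad n%:R) (x n)) /\
    forall n, exists2 r : R, 0 < r &
      forall m, x m = x n \/ r <= mdist (x n) (x m).
  apply: (isolated_choice (B := fun n => h @` bad n%:R)) => [m n mn|n].
    move=> _ [y yb <-]; exists y => //; by apply: bad_le yb; rewrite ler_nat.
  by have [z zb] := badx n%:R; exists (h z); exists z.
have [g gE] := hD (Dinf_dist (range x)); have [K K0 gK] := DinfP g.
have [n Kn] : exists n : nat, K <= n%:R.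
  by exists (Num.bound K); rewrite ltW// archi_boundP.
have [y yb hy] := xB n; apply: yb; have [r r0 rP] := xiso n.
(* Within [r / 2] of [x n] the nearest point of the range of [x] is [x n], and
   below distance [1] the cap is inactive. *)
have r1 : 0 < Num.min 1 (r / 2) by rewrite lt_min ltr01 divr_gt0.
near=> z.
have hz : mdist (h y) (h z) < Num.min 1 (r / 2) by near: z; exact: h_cts.
move: hz; rewrite lt_min => /andP[hz1 hz2].
have : `|g z - g y| <= K * mdist y z by near: z; have [] := gK y.
rewrite !gE /= [capped_dist _ (h y)]capped_dist_mem ?subr0; last by exists n.
rewrite ger0_norm ?capped_dist_ge0// => gz.
apply: (@le_trans _ _ (K * mdist y z)); last by rewrite ler_wpM2r ?mdist_ge0.
apply: le_trans gz; apply: capped_dist_ge; first by exists (x n), n.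
move=> _ [m _ <-]; rewrite le_min (ltW hz1) /=.
have [->|] := rP m; first by rewrite -hy metric_sym.
have := metric_triangle (h y) (h z) (x m); rewrite -hy; lra.
Unshelve. all: by end_near. Qed.

(** * The three equivalent conditions *)

(** Positivity in terms of the ring structure and the constants: a nonnegative
[f] gives [f + c >= c], whose reciprocal is bounded and pointwise Lipschitz,
while at a point where [f] is negative [f + c] vanishes for a suitable [c]. *)
Lemma Dinf_ge0P (R : realType) (X : metricType R) (f : Dinf X) :
  ((0 : Dinf X) <= f)%O <-> forall c : R, 0 < c ->
    exists g : Dinf X, (f + c *: (1 : Dinf X)) * g = 1.
Proof.
split=> [/Dinf_leP f0 c c0|fu]; last first.
  apply/Dinf_leP => x; rewrite leNgt; apply/negP => fx.
  have /fu[g /(congr1 (fun k : Dinf X => k x))] : 0 < - f x by rewrite oppr_gt0.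
  rewrite Dinf_mulE Dinf_addE Dinf_scaleE Dinf_oneE mulr1 subrr mul0r => /eqP.
  by rewrite eq_sym oner_eq0.
have fc x : c <= f x + c by rewrite lerDr; exact: f0.
have fc0 x : 0 < f x + c := lt_le_trans c0 (fc x).
have [K K0 fK] := DinfP f.
have gD : (fun x => (f x + c)^-1 : R^o) \in Dinf_pred X.
  apply/Dinf_predP; exists (Num.max c^-1 (c^-1 * c^-1 * K)) => x; split.
    by rewrite gtr0_norm ?invr_gt0// le_max lef_pV2 ?posrE// fc.
  have [_] := fK x; apply: filterS => y fxy.
  have -> : (f y + c)^-1 - (f x + c)^-1 =
      (f y + c)^-1 * (f x + c)^-1 * (f x - f y).
    by field; rewrite !gt_eqF.
  apply: (@le_trans _ _ (c^-1 * c^-1 * (K * mdist x y))).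
    rewrite !normrM distrC !(@gtr0_norm _ _^-1) ?invr_gt0//.
    by rewrite !ler_pM ?mulr_ge0 ?invr_ge0 ?(ltW (fc0 _))// lef_pV2 ?posrE// fc.
  by rewrite mulrA ler_wpM2r ?mdist_ge0// le_max lexx orbT.
exists (MkDinf gD); apply/val_inj/funext => x.
rewrite /= -[LHS]/((f x + c * 1) * (f x + c)^-1) mulr1.
by rewrite divff// gt_eqF.
Qed.

Lemma algebra_iso_order (R : realType) (X Y : metricType R)
    (phi : Dinf X -> Dinf Y) (psi : Dinf Y -> Dinf X) :
  cancel phi psi -> cancel psi phi -> linear phi -> monoid_morphism phi ->
  unital_order_isomorphism phi psi.
Proof.
move=> phiK psiK lin [phi1 phiM]; split=> // f g.
have sub_ge0 (Z : metricType R) (u v : Dinf Z) :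
    (u <= v)%O <-> ((0 : Dinf Z) <= (-1) *: u + v)%O.
  split=> /Dinf_leP uv; apply/Dinf_leP => z; have := uv z.
    by rewrite Dinf_addE Dinf_scaleE mulN1r addrC subr_ge0.
  by rewrite Dinf_addE Dinf_scaleE mulN1r addrC subr_ge0.
have phi_add c (k : Dinf X) :
    phi (k + c *: (1 : Dinf X)) = phi k + c *: (1 : Dinf Y).
  by rewrite addrC lin phi1 addrC.
apply/idP/idP => /sub_ge0/Dinf_ge0P fg; apply/sub_ge0/Dinf_ge0P => c c0.
  have [k kE] := fg _ c0; exists (psi k); apply: (can_inj phiK).
  by rewrite phiM phi_add lin psiK phi1.
have [k kE] := fg _ c0; exists (phi k).
by rewrite -lin -phi_add -phiM kE.
Qed.

(** The lattice operations are determined by the order, and [f <= g] means that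
[f] is the meet of [f] and [g]. *)
Lemma lattice_isoP (R : realType) (X Y : metricType R) :
  unital_vector_lattice_isomorphic X Y <->
  exists (phi : Dinf X -> Dinf Y) psi, unital_order_isomorphism phi psi.
Proof.
split=> [[phi [[psi phiK psiK] lin phiI _ phi1]]|[phi [psi iso]]].
  exists phi, psi; split=> // f g.
  by rewrite !leEmeet -phiI (inj_eq (can_inj phiK)).
have [phiK psiK lin phi1 phi_le] := iso.
have psi_le f g : (psi f <= psi g)%O = (f <= g)%O by rewrite -phi_le !psiK.
exists phi; split=> //; first by exists psi.
- move=> f g; apply/le_anti/andP; split.
    by rewrite lexI !phi_le leIl leIr.
  by rewrite -psi_le phiK lexI -2!(phi_le (psi _)) !psiK leIl leIr.
- move=> f g; apply/le_anti/andP; split.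
    by rewrite -psi_le phiK leUx -!phi_le !psiK leUl leUr.
  by rewrite leUx !phi_le leUl leUr.
Qed.

Lemma homeo_algebra_iso (R : realType) (X Y : metricType R) :
  inf_Lipschitz_homeomorphic X Y -> unital_algebra_isomorphic X Y.
Proof.
move=> [h [k [hK kK hD kD]]].
exists (fun f => MkDinf (Dinf_comp f kD)); split.
- by exists (fun g => MkDinf (Dinf_comp g hD)) => f;
    apply/val_inj/funext => x /=; rewrite ?hK ?kK.
- by move=> c f g; exact/val_inj.
- by split=> [|f g]; exact/val_inj.
Qed.

Lemma order_iso_homeo (R : realType) (X Y : metricType R)
    (phi : Dinf X -> Dinf Y) (psi : Dinf Y -> Dinf X) :
  complete_space X -> complete_space Y ->
  unital_order_isomorphism phi psi -> inf_Lipschitz_homeomorphic X Y.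
Proof.
move=> cX cY iso; have [phiK psiK _ _ _] := iso.
have [k kE] := choice (order_iso_point cX iso).
have [h hE] := choice (order_iso_point cY (order_iso_sym iso)).
exists h, k; split.
- by move=> x; apply: Dinf_separated => f; rewrite -kE -hE phiK.
- by move=> y; apply: Dinf_separated => g; rewrite -hE -kE psiK.
- by apply: Dspace_of_comp => g; exists (psi g) => x; rewrite hE.
- by apply: Dspace_of_comp => f; exists (phi f) => y; rewrite kE.
Qed.

Theorem theorem4p7 (R : realType) (X Y : metricType R)
    (cX : complete_space X) (cY : complete_space Y)
    (qX : locally_radially_quasiconvex X)
    (qY : locally_radially_quasiconvex Y) :
  (inf_Lipschitz_homeomorphic X Y <-> unital_algebra_isomorphic X Y) /\
  (unital_algebra_isomorphic X Y <-> unital_vector_lattice_isomorphic X Y).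
Proof.
have algebra_lattice :
    unital_algebra_isomorphic X Y -> unital_vector_lattice_isomorphic X Y.
  move=> [phi [[psi phiK psiK] lin mul]]; apply/lattice_isoP.
  by exists phi, psi; exact: algebra_iso_order.
have lattice_homeo :
    unital_vector_lattice_isomorphic X Y -> inf_Lipschitz_homeomorphic X Y.
  by move=> /lattice_isoP[phi [psi]]; exact: order_iso_homeo.
split; first by split=> [/homeo_algebra_iso|/algebra_lattice/lattice_homeo].
by split=> [/algebra_lattice|/lattice_homeo/homeo_algebra_iso].
Qed.
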